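(* Let $n$ be odd, let $k$ be a positive integer with $\gcd(k,n)=1$, let $L=GF(2^n)$, and let $t\in\{2,3\}$. Let $C$ be the binary code of length $2^n-1$ whose coordinates are indexed by $x\in L^*$ and which consists of all $(c_x)_{x\in L^*}\in GF(2)^{L^*}$ with $$\sum_{x\in L^*} c_x\,x=0,\qquad \sum_{x\in L^*} c_x\,x^{2^k+1}=0,\qquad \sum_{x\in L^*} c_x\,x^{2^{tk}+1}=0 .$$ Then $C$ is a triple error correcting code with BCH parameters, i.e. $C$ has parameters $[2^n-1,\,2^n-3n-1,\,7]$ (length $2^n-1$, dimension $2^n-3n-1$, minimum Hamming distance $7$), and its weight distribution equals that of the binary primitive triple error correcting BCH code of length $2^n-1$.
   Context: $L^*=L\setminus\{0\}$. Equivalently, $C$ is the nullspace of the $3n\times(2^n-1)$ binary matrix whose column indexed by $x\in L^*$ consists of the coordinate vectors (with respect to a fixed basis of $L$ over $GF(2)$) of $x$, $x^{2^k+1}$ and $x^{2^{tk}+1}$ stacked on top of each other.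
   Formalization: The formal theorem additionally assumes n > 3 (so n ≥ 5, as n is odd); for n = 1 and n = 3 the claimed dimension 2^n − 3n − 1 equals −2, so the statement is false there. *)

(* Defs.v *)
From HB Require Import structures.
From mathcomp Require Import all_boot all_order all_algebra all_fingroup all_field.
Set Implicit Arguments. Unset Strict Implicit. Unset Printing Implicit Defensive.
Import GRing.Theory.
Local Open Scope ring_scope.

Notation Lstar L := {x : L | x != 0}%type.

Definition word (L : finFieldType) := {ffun Lstar L -> 'F_2}.

(* The code { c | sum c_x x = 0, sum c_x x^a = 0, sum c_x x^b = 0 };
   c_x * y for c_x in GF(2) is the GF(2)-scalar action on L (char L = 2),
   written as the nat cast ((c_x : nat)%:R * y). *)
Definition code (L : finFieldType) (a b : nat) : {set word L} :=
  [set c : word L |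
    [&& \sum_(x : Lstar L) ((c x : nat)%:R * val x) == 0,
        \sum_(x : Lstar L) ((c x : nat)%:R * (val x) ^+ a) == 0
      & \sum_(x : Lstar L) ((c x : nat)%:R * (val x) ^+ b) == 0]].

Definition wt (L : finFieldType) (c : word L) : nat := #|[set x | c x != 0]|.

(* Binary primitive triple error correcting BCH code of length 2^n - 1
   (zeros alpha, alpha^3, alpha^5), in the same coordinates. *)
Definition bch3 (L : finFieldType) : {set word L} := code L 3 5.

(* Main.v *)
Require Import Defs.
From HB Require Import structures.
From mathcomp Require Import all_boot all_order all_algebra all_fingroup all_field.
From mathcomp Require Import ring zify.
Import Order.TTheory GRing.Theory Num.Theory.

(**
Minimum distance. Write s for x |-> x^(2^k), whose fixed field is F_2, and let
{x1,x2,x3} u {x4,x5,x6} be the support of a word of weight 6 of the extended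
code. With a = x1+x2, b = x1+x3, c = x4+x5, d = x4+x6 the parity checks become
W_i(a,b) = W_i(c,d) for i = 1 and i = t, where
W_i(x,y) = x s^i(y) - s^i(x) y. The F_2-span of (a,b) is the solution set of
s^2(x) = p s(x) + q x with q = -s(W_1)/W_1 and p = W_2/W_1, while
W_3 = (s(p) p + s(q)) W_1. As n is odd, p |-> s(p) p is injective, so (c,d)
satisfies the same recurrence as (a,b), hence spans the same plane, and two of
the six points coincide.

Weight distribution. For u in L^3 let S(u) be the character sum over L of the
quadratic form defined by u, and put q = 2^n. Then q divides S(u)^2 and n is
odd, so S(u)^2 = 2 q s^2 with s an integer and
S(u)^2 (S(u)^2 - 2q) (S(u)^2 - 8q) >= 0. Since d >= 7, the moments of S up to
order 6 are explicit, and they force equality for every nonzero u. The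
resulting recurrence determines all moments of S, hence the weight
distribution, which is thus common to all the codes in question, BCH included.
The moment of order 7 is too large for a code without words of weight 7.
*)

Set Implicit Arguments.
Unset Strict Implicit.
Unset Printing Implicit Defensive.
Local Open Scope ring_scope.

(** * Minimum distance *)

Section Wronskian.

Variables (F : fieldType) (s : {rmorphism F -> F}).
Hypothesis fix_s : forall x, s x = x -> x = 0 \/ x = 1.
Hypothesis norm_inj : forall x y, s x * x = s y * y -> x = y.

Definition wr (f : F -> F) (a b : F) := a * f b - f a * b.

(** If neither is 0, the vanishing says that [a / b] is fixed by [s], hence equal to 1. *)
Lemma wr1_eq0 a b : wr s a b = 0 -> [\/ a = 0, b = 0 | a = b].
Proof.
move=> /eqP; rewrite /wr subr_eq0 => /eqP H.
have [->|a0] := eqVneq a 0; first by constructor 1.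
have [->|b0] := eqVneq b 0; first by constructor 2.
constructor 3; have sb0 : s b != 0 by rewrite fmorph_eq0.
have /fix_s [] : s (a / b) = a / b.
- by rewrite fmorph_div; apply/eqP; rewrite eqr_div // -H.
- by move/eqP; rewrite mulf_eq0 invr_eq0 (negPf a0) (negPf b0).
- by move/(canRL (divfK b0)); rewrite mul1r.
Qed.

(* Coefficients of the recurrence [s (s x) = p * s x + q * x] satisfied by a and b. *)
Definition recp (a b : F) := wr (s \o s) a b / wr s a b.
Definition recq (a b : F) := - s (wr s a b) / wr s a b.

Lemma recP a b : wr s a b != 0 ->
  s (s a) = recp a b * s a + recq a b * a /\
  s (s b) = recp a b * s b + recq a b * b.
Proof.
rewrite /recp /recq /wr /= => D0.
by split; rewrite rmorphB !rmorphM; field.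
Qed.

(** Applying [s] to the recurrence gives s^3(x) = (s(p) p + s(q)) s(x) + s(p) q x; the last term
    cancels in the determinant. *)
Lemma wr3E a b : wr s a b != 0 ->
  wr (s \o (s \o s)) a b =
    (s (recp a b) * recp a b + s (recq a b)) * wr s a b.
Proof.
move=> D0; have [Ea Eb] := recP D0.
move: (recp a b) (recq a b) Ea Eb => p q Ea Eb.
have Ea' := congr1 s Ea; have Eb' := congr1 s Eb.
rewrite !(rmorphD, rmorphM) /= in Ea' Eb'.
rewrite /wr /= Ea' Eb' Ea Eb; ring.
Qed.

(** Cramer's rule gives [c = x * a + y * b] together with its image under [s], where [s] does not
    act on x and y. The recurrence extends this to [s (s c)]. Comparison with the honest images
    under [s] yields a homogeneous system in [s x - x] and [s y - y] of determinant [s (wr s a b)],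
    so x and y lie in F_2. *)
Lemma rec_span a b c : wr s a b != 0 ->
  s (s c) = recp a b * s c + recq a b * c -> c \in [:: 0; a; b; a + b].
Proof.
move=> D0 Ec; have [Ea Eb] := recP D0.
move: (recp a b) (recq a b) Ec Ea Eb => p q Ec Ea Eb.
pose x := wr s c b / wr s a b; pose y := wr s a c / wr s a b.
have cE : c = x * a + y * b by rewrite /x /y /wr; move: D0; rewrite /wr => ?; field.
have scE : s c = x * s a + y * s b by rewrite /x /y /wr; move: D0; rewrite /wr => ?; field.
clearbody x y.
have ssE : s (s c) = x * s (s a) + y * s (s b) by rewrite Ec scE cE Ea Eb; ring.
have scE' : s c = s x * s a + s y * s b by rewrite {1}cE rmorphD !rmorphM.
have ssE' : s (s c) = s x * s (s a) + s y * s (s b).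
  by rewrite scE rmorphD !rmorphM.
have sD0 : s (wr s a b) != 0 by rewrite fmorph_eq0.
have fx : s x = x.
  apply/eqP; rewrite -subr_eq0 -(mulIr_eq0 _ (mulIf sD0)) /wr rmorphB !rmorphM.
  have -> : (s x - x) * (s a * s (s b) - s (s a) * s b) =
    (s x * s a + s y * s b - (x * s a + y * s b)) * s (s b) -
    (s x * s (s a) + s y * s (s b) - (x * s (s a) + y * s (s b))) * s b by ring.
  by rewrite -scE -scE' -ssE -ssE' !subrr !mul0r subrr.
have fy : s y = y.
  apply/eqP; rewrite -subr_eq0 -(mulIr_eq0 _ (mulIf sD0)) /wr rmorphB !rmorphM.
  have -> : (s y - y) * (s a * s (s b) - s (s a) * s b) =
    (s x * s (s a) + s y * s (s b) - (x * s (s a) + y * s (s b))) * s a -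
    (s x * s a + s y * s b - (x * s a + y * s b)) * s (s a) by ring.
  by rewrite -scE -scE' -ssE -ssE' !subrr !mul0r subrr.
rewrite !inE cE.
case: (fix_s fx) => ->; case: (fix_s fy) => ->;
  by rewrite ?mul0r ?mul1r ?add0r ?addr0 eqxx ?orbT.
Qed.

Lemma wr_span a b c d t : (t == 2) || (t == 3) -> wr s a b != 0 ->
  wr s a b = wr s c d -> wr (iter t s) a b = wr (iter t s) c d ->
  (c \in [:: 0; a; b; a + b]) && (d \in [:: 0; a; b; a + b]).
Proof.
move=> ht D0 E1 Et; have D0' := D0; rewrite E1 in D0'.
have Eq : recq a b = recq c d by rewrite /recq E1.
have Ep : recp a b = recp c d.
  case/orP: ht => /eqP ht; rewrite ht in Et; first by rewrite /recp E1; congr (_ / _).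
  apply: norm_inj; have := wr3E D0; have := wr3E D0'.
  rewrite -[wr (s \o (s \o s)) c d]Et E1 => -> /(mulIf D0').
  by rewrite Eq => /addIr ->.
have [Ec Ed] := recP D0'; rewrite -Ep -Eq in Ec Ed.
by rewrite (rec_span D0 Ec) (rec_span D0 Ed).
Qed.

End Wronskian.

(** * Powers of the Frobenius map in characteristic 2 *)

Definition frob (L : finFieldType) (charL : 2%N \in [pchar L]) (k : nat) (x : L) :=
  x ^+ (2 ^ k).

Section Frobenius.

Variables (L : finFieldType) (charL : 2%N \in [pchar L]).

Lemma frobD k : {morph frob charL k : x y / x + y}.
Proof. by move=> x y; rewrite /frob exprDn_pchar // pnatX pnatE // charL. Qed.

Fact frob_nmod_morphism k : nmod_morphism (frob charL k).
Proof. by split; [rewrite /frob expr0n expn_eq0 | exact: frobD]. Qed.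

Fact frob_monoid_morphism k : monoid_morphism (frob charL k).
Proof. by split=> [|x y]; rewrite /frob ?expr1n ?exprMn. Qed.

HB.instance Definition _ k :=
  GRing.isNmodMorphism.Build L L (frob charL k) (frob_nmod_morphism k).
HB.instance Definition _ k :=
  GRing.isMonoidMorphism.Build L L (frob charL k) (frob_monoid_morphism k).

Lemma iter_frob k t x : iter t (frob charL k) x = x ^+ (2 ^ (t * k)).
Proof.
elim: t => [|t IH]; first by rewrite mul0n expr1.
by rewrite iterS IH /frob -exprM -expnD mulSn addnC.
Qed.

(** By Bezout u m = v n + 1, so the 2^(u m)-th power of x is both x and x^2. *)
Lemma frob_fixed m n (x : L) : coprime m n -> (0 < m)%N -> #|L| = (2 ^ n)%N ->
  frob charL m x = x -> x = 0 \/ x = 1.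
Proof.
move=> cop m0 cardL xm.
have iterx j d : x ^+ (2 ^ d) = x -> x ^+ (2 ^ (j * d)) = x.
  by move=> xd; elim: j => [|j IH]; rewrite ?expr1 // mulSn expnD exprM xd IH.
case: (egcdnP n m0) => u v uv _; rewrite (eqP cop) in uv.
have : x ^+ (2 ^ (u * m)) = x ^+ 2.
  by rewrite uv expnD exprM iterx // -cardL expf_card.
rewrite iterx // => /esym/eqP; rewrite -subr_eq0.
have -> : x ^+ 2 - x = x * (x - 1) by ring.
by rewrite mulf_eq0 subr_eq0 => /orP[]/eqP; [left | right].
Qed.

(** The ratio r = x / y satisfies s(r) = 1 / r, so s^2 fixes it; since 2k is coprime to the odd n, r
    is 0 or 1. *)
Lemma frob_norm_inj k n (x y : L) : odd n -> (0 < k)%N -> coprime k n ->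
  #|L| = (2 ^ n)%N ->
  frob charL k x * x = frob charL k y * y -> x = y.
Proof.
move=> on k0 cop cardL E.
have [y0|y0] := eqVneq y 0.
  move: E; rewrite y0 mulr0 => /eqP.
  by rewrite mulf_eq0 fmorph_eq0 orbb => /eqP.
have E1 : frob charL k (x / y) * (x / y) = 1.
  by rewrite fmorph_div mulf_div E divff // mulf_neq0 // fmorph_eq0.
have r0 : x / y != 0 by apply: contra_eq_neq E1 => ->; rewrite mulr0 eq_sym oner_eq0.
have /(frob_fixed _ _ cardL) [] : frob charL (2 * k) (x / y) = x / y.
- have Fr : frob charL k (x / y) = (x / y)^-1.
    by rewrite (canRL (mulfK r0) E1) mul1r.
  transitivity (frob charL k (frob charL k (x / y))).
    exact: esym (iter_frob k 2 (x / y)).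
  by rewrite Fr fmorphV /= Fr invrK.
- by rewrite coprimeMl cop andbT prime_coprime // dvdn2 negbK.
- by rewrite muln_gt0.
- by move/eqP; rewrite (negPf r0).
- by move=> /(canRL (divfK y0)); rewrite mul1r.
Qed.

End Frobenius.

(** Words are encoded by their supports in all of L. For positive exponents the point 0 contributes
    nothing to the sums, so it may be added or removed freely; the members of even size form the
    parity extension of the code. *)
Definition zero_synd (L : finFieldType) (a b : nat) : {set {set L}} :=
  [set A : {set L} | [&& \sum_(x in A) x == 0, \sum_(x in A) x ^+ a == 0
                       & \sum_(x in A) x ^+ b == 0]].

(** * Supports with at most six points *)

Section MinimumDistance.

Variables (L : finFieldType) (n k t : nat).
Hypotheses (odd_n : odd n) (k_gt0 : (0 < k)%N) (cop_kn : coprime k n).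
Hypotheses (ht : (t == 2%N) || (t == 3%N)) (cardL : #|L| = (2 ^ n)%N).

Let charL : 2%N \in [pchar L] := card_finPcharP cardL isT.
Local Notation s := (frob charL k).
Local Notation Z := (zero_synd L (2 ^ k + 1) (2 ^ (t * k) + 1)).

Let addxx (x : L) : x + x = 0. Proof. exact: addrr_pchar2. Qed.
Let two0 (x : L) : 2%:R * x = 0. Proof. by rewrite mulr_natl mulr2n addxx. Qed.
Let oppE (x : L) : - x = x. Proof. exact: oppr_pchar2. Qed.

Lemma frob_wr1_eq0 a b : wr s a b = 0 -> [\/ a = 0, b = 0 | a = b].
Proof. by apply: wr1_eq0 => x; apply: frob_fixed cardL. Qed.

(** The right side involves x, y, z only through their sum and their part of the check sum of
    [u * f u]; two triples that agree in both have equal determinants. *)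
Lemma wr_triple (f : L -> L) (x y z : L) : {morph f : u v / u + v} ->
  wr f (x + y) (x + z) =
    (x + y + z) * f (x + y + z) + x * f x + y * f y + z * f z.
Proof.
move=> fD; rewrite /wr oppE !fD.
set X := f x; set Y := f y; set W := f z.
apply/eqP; rewrite -subr_eq0 oppE; apply/eqP.
(* [ring] ignores the characteristic, so the sum of the two sides is displayed as an explicit
   double. *)
transitivity (2%:R * (x * X + x * X + y * Y + z * W + x * Y + x * W + y * X + z * X + y * W + z * Y)); first by ring.
exact: two0.
Qed.

Lemma zero_synd_even A : A \in Z -> ~~ odd #|A| -> (#|A| <= 6)%N -> A = set0.
Proof.
have sD := rmorphD s; have stD : {morph iter t s : u v / u + v}.
  by move=> x y; rewrite !iter_frob exprDn_pchar // pnatX pnatE // charL.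
rewrite inE -!(big_enum _ _ A) cardE => /and3P[/eqP]; have := enum_uniq A.
have tE x : x ^+ (2 ^ (t * k) + 1) = x * iter t s x.
  by rewrite iter_frob addn1 exprS.
have sE x : x ^+ (2 ^ k + 1) = x * s x by rewrite addn1 exprS.
have set0E : enum A = [::] -> A = set0.
  by move=> e; apply/setP => x; rewrite -mem_enum e inE.
have add_eq0 (x y : L) : x + y = 0 -> x = y.
  by move/eqP; rewrite addr_eq0 oppE => /eqP.
(* Only supports of 0, 2, 4 or 6 points survive the parity and size bounds. *)
case: (enum A) set0E => [|x1 [|x2 [|x3 [|x4 [|x5 [|x6 [|x7 e]]]]]]] //= set0E.
- by move=> *; apply: set0E.
- move=> U; rewrite !big_cons big_nil addr0 => /add_eq0 e.
  by move: U; rewrite e !inE eqxx.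
- rewrite !big_cons !big_nil !addr0 !sE => U E0 /eqP E1 _ _ _.
  have x4E : x1 + x2 + x3 = x4 by apply: add_eq0; rewrite -E0; ring.
  have D0 : wr s (x1 + x2) (x1 + x3) = 0.
    by rewrite wr_triple // x4E -E1; ring.
  case: (frob_wr1_eq0 D0) => [/add_eq0 e|/add_eq0 e|/addrI e];
    by move: U; rewrite e !inE eqxx ?orbT /= ?andbF.
- rewrite !big_cons !big_nil !addr0 !sE !tE => U E0 /eqP E1 /eqP Et _ _.
  have gE : x1 + x2 + x3 = x4 + x5 + x6 by apply: add_eq0; rewrite -E0; ring.
  have wrE f : {morph f : u v / u + v} ->
      x1 * f x1 + (x2 * f x2 + (x3 * f x3 + (x4 * f x4 + (x5 * f x5 + x6 * f x6)))) = 0 ->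
    wr f (x1 + x2) (x1 + x3) = wr f (x4 + x5) (x4 + x6).
    move=> fD Ef; rewrite !wr_triple // gE; apply: add_eq0.
    set g := _ * f (x4 + x5 + x6).
    by rewrite -[RHS](two0 g) -[RHS]addr0 -Ef; ring.
  have [/frob_wr1_eq0|D0] := eqVneq (wr s (x1 + x2) (x1 + x3)) 0.
    case=> [/add_eq0 e|/add_eq0 e|/addrI e];
      by move: U; rewrite e !inE eqxx ?orbT /= ?andbF.
  have fixs x : s x = x -> x = 0 \/ x = 1 by apply: frob_fixed cardL.
  have norms x y : s x * x = s y * y -> x = y by apply: frob_norm_inj cardL.
  have := wr_span fixs norms ht D0 (wrE _ sD E1) (wrE _ stD Et).
  (* With c = x4 + x5 and d = x4 + x6, x4 equals x1 + x2 + x3 + c + d. Since c and d are distinct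
     nonzero elements of the plane {0, a, b, a + b}, c + d is its third nonzero element, so x4 is
     one of x1, x2, x3. *)
  have x4E : x4 = x1 + x2 + x3 + (x4 + x5) + (x4 + x6).
    by rewrite gE -[LHS]addr0 -(two0 (x4 + x5 + x6)); ring.
  have c0 : x4 + x5 != 0.
    by apply: contraTneq U => /add_eq0 ->; rewrite !inE eqxx /= !andbF.
  have d0 : x4 + x6 != 0.
    by apply: contraTneq U => /add_eq0 ->; rewrite !inE eqxx ?orbT /= !andbF.
  have cd0 : x4 + x5 != x4 + x6.
    by apply: contraTneq U => /addrI ->; rewrite !inE eqxx ?orbT /= !andbF.
  have x4N y w : x4 = y + 2%:R * w -> y \in [:: x1; x2; x3] -> A = set0.
    rewrite two0 addr0 => <- x4in.
    have : uniq ([:: x1; x2; x3] ++ [:: x4; x5; x6]) by exact: U.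
    rewrite cat_uniq.
    by case/and3P=> _ /hasPn /(_ x4); rewrite x4in inE eqxx => /(_ isT).
  have [h1 h2 h3] : [/\ x1 \in [:: x1; x2; x3], x2 \in [:: x1; x2; x3] & x3 \in [:: x1; x2; x3]].
    by rewrite !inE !eqxx ?orbT.
  rewrite !inE => /andP[/or4P[]/eqP c /or4P[]/eqP d];
    first [by rewrite c eqxx in c0 | by rewrite d eqxx in d0
          | by rewrite c d eqxx in cd0
          | rewrite c d in x4E].
  + by apply: (x4N x1 (x1 + x2 + x3)) => //; rewrite {1}x4E; ring.
  + by apply: (x4N x2 (x1 + x2 + x3 + x1)) => //; rewrite {1}x4E; ring.
  + by apply: (x4N x1 (x1 + x2 + x3)) => //; rewrite {1}x4E; ring.
  + by apply: (x4N x3 (x1 + x2 + x3 + x1)) => //; rewrite {1}x4E; ring.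
  + by apply: (x4N x2 (x1 + x2 + x3 + x1)) => //; rewrite {1}x4E; ring.
  + by apply: (x4N x3 (x1 + x2 + x3 + x1)) => //; rewrite {1}x4E; ring.
Qed.
End MinimumDistance.

(** * Moments of character sums *)

Section Flip.

Variable T : finType.
Implicit Types (A : {set T}) (x : T).

Definition flip x A := [set y | (y == x) (+) (y \in A)].

Lemma flipK x : involutive (flip x).
Proof. by move=> A; apply/setP=> y; rewrite !inE addbA addbb. Qed.

Lemma flip_in x A : x \in A -> flip x A = A :\ x.
Proof. by move=> Ax; apply/setP=> y; rewrite !inE; case: eqVneq => // ->; rewrite Ax. Qed.

Lemma flip_notin x A : x \notin A -> flip x A = x |: A.
Proof.
by move=> Ax; apply/setP=> y; rewrite !inE; case: eqVneq => // ->; rewrite (negPf Ax).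
Qed.

Lemma card_flip x A : #|flip x A| = (if x \in A then #|A|.-1 else #|A|.+1).
Proof.
case: ifPn => Ax; first by rewrite flip_in // (cardsD1 x A) Ax.
by rewrite flip_notin // cardsU1 Ax.
Qed.

Lemma prod_flip (R : comPzRingType) (F : T -> R) x A : F x ^+ 2 = 1 ->
  \prod_(y in flip x A) F y = F x * \prod_(y in A) F y.
Proof.
move=> Fx; have [Ax|Ax] := boolP (x \in A); last by rewrite flip_notin // big_setU1.
by rewrite flip_in // (big_setD1 x Ax) /= mulrA -expr2 Fx mul1r.
Qed.

Lemma sum_flip0 (V : zmodType) (F : T -> V) x A : F x = 0 ->
  \sum_(y in flip x A) F y = \sum_(y in A) F y.
Proof.
move=> Fx; have [Ax|Ax] := boolP (x \in A).
  by rewrite flip_in // [RHS](big_setD1 x Ax) /= Fx add0r.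
by rewrite flip_notin // big_setU1 //= Fx add0r.
Qed.

(* [walk_count q j s] is the number of sequences x_1, ..., x_j in a set of q
   points such that the points occurring an odd number of times form a
   prescribed s-set. *)
Fixpoint walk_count (q : int) (j s : nat) : int :=
  if j is j'.+1 then
    s%:Z * walk_count q j' s.-1 + (q - s%:Z) * walk_count q j' s.+1
  else (s == 0%N)%:Z.

(** As F takes square 1, a product of j values depends only on the set of points used an odd number
    of times, and a further factor [F x] toggles x in that set. *)
Lemma sum_expn_flip (F : T -> int) j : (forall x, F x ^+ 2 = 1) ->
  (\sum_x F x) ^+ j =
  \sum_(A : {set T}) walk_count #|T| j #|A| * \prod_(x in A) F x.
Proof.
move=> F2; elim: j => [|j IH].
  rewrite expr0 (bigD1 set0) //= cards0 big_set0 mulr1 big1 ?addr0 // => A.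
  by rewrite -cards_eq0 => /negPf ->; rewrite mul0r.
rewrite exprS IH mulr_sumr.
under eq_bigr => A _ do rewrite mulr_suml.
rewrite exchange_big /=.
under eq_bigr => x _ do rewrite (reindex_inj (can_inj (flipK x))) /=.
rewrite exchange_big /=; apply: eq_bigr => A _.
under eq_bigr => x _ do
  rewrite prod_flip // mulrCA (mulrA (F x)) -expr2 F2 mul1r card_flip.
rewrite -mulr_suml; congr (_ * _).
rewrite (bigID (mem A)) /=.
rewrite (eq_bigr (fun=> walk_count #|T| j #|A|.-1)) => [|x ->] //.
rewrite [X in _ + X](eq_bigr (fun=> walk_count #|T| j #|A|.+1)) => [|x /negPf ->] //.
rewrite !sumr_const -mulr_natl -[X in _ + X]mulr_natl natz; congr (_ * _ + _ * _).
by rewrite natz -(cardC A) PoszD addrC addKr; congr Posz; apply: eq_card.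
Qed.

End Flip.

(** * Additive characters and quadratic sums *)

Lemma sum_opp_eq0 (T : finType) (h : T -> T) (F : T -> int) :
  injective h -> (forall x, F (h x) = - F x) -> \sum_x F x = 0.
Proof.
move=> h_inj Fh.
have : \sum_x F x = - \sum_x F x.
  rewrite {1}(reindex_inj h_inj) /=.
  by under eq_bigr => x _ do rewrite Fh; rewrite sumrN.
lia.
Qed.

Lemma F2_cases (z : 'F_2) : z = 0 \/ z = 1.
Proof. by case: z => [[|[|//]]] p; [left | right]; apply: val_inj. Qed.

(** Some F_2-coordinate is nonzero at 1; its sign character serves in place of the trace
    character. *)
Lemma exists_character (L : finFieldType) : 2%N \in [pchar L] ->
  exists2 psi : L -> int,
    (forall x y, psi (x + y) = psi x * psi y) /\ (forall x, psi x ^+ 2 = 1)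
    & exists v, psi v = -1.
Proof.
move=> charL; pose V : vectType 'F_2 := pPrimeCharType charL.
pose X := vbasis (fullv : {vspace V}).
have [i ci] : exists i, coord X i (1 : V) != 0.
  apply/existsP; apply: contraT; rewrite negb_exists => /forallP c0.
  have := coord_vbasis (memvf (1 : V)).
  rewrite big1 => [/eqP|i _]; first by rewrite oner_eq0.
  by have := c0 i; rewrite negbK => /eqP ->; rewrite scale0r.
exists (fun x => if coord X i (x : V) == 0 then 1 else -1); last first.
  by exists 1; rewrite (negPf ci).
split=> [x y|x]; last by case: ifP.
have -> : coord X i (x + y : V) = coord X i (x : V) + coord X i (y : V).
  exact: linearD.
have F11 : 1 + 1 = 0 :> 'F_2 by apply: val_inj.
case: (F2_cases (coord X i (x : V))) => ->; case: (F2_cases (coord X i (y : V))) => ->;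
  by rewrite ?F11 ?addr0 ?add0r ?eqxx ?oner_eq0 ?mul1r ?mulr1 ?mulrNN ?mulr1.
Qed.

Lemma walk_count_gt q j s : (j < s)%N -> walk_count q j s = 0.
Proof.
elim: j s => [|j IH] [|s] //= js.
by rewrite !IH ?mulr0 ?addr0 // ltnW // ltnW.
Qed.

(** A j-set is reached in j steps only through its j! orderings. Together with [walk_count_gt] this
    makes the moment equations triangular. *)
Lemma walk_count_diag q j : walk_count q j j = j`!%:Z.
Proof.
elim: j => //= j ->.
by rewrite walk_count_gt ?mulr0 ?addr0 // factS PoszM.
Qed.

(** Here F is the sign of a quadratic form and beta that of its polarization. Expanding the square
    over pairs x, x + y, the sum over x of [beta y x] vanishes unless y lies in the radical, where
    it is [#|L|]. *)
Lemma quadratic_sum_sqr (L : finFieldType) (F : L -> int) (beta : L -> L -> int) :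
  (forall x, F x ^+ 2 = 1) ->
  (forall x y, F (x + y) = F x * F y * beta y x) ->
  (forall y x x', beta y (x + x') = beta y x * beta y x') ->
  (forall y x, beta y x ^+ 2 = 1) ->
  exists m, (\sum_x F x) ^+ 2 = #|L|%:Z * m.
Proof.
move=> F2 FD bD b2.
exists (\sum_(y | [forall x, beta y x == 1]) F y).
rewrite expr2 mulr_suml.
under eq_bigr => x _.
  rewrite (reindex_inj (addrI x)) /= mulr_sumr.
  under eq_bigr => y _ do rewrite FD !mulrA -expr2 F2 mul1r.
  over.
rewrite exchange_big /= mulr_sumr [RHS]big_mkcond /=; apply: eq_bigr => y _.
rewrite -mulr_sumr; case: ifPn => [/forallP b1|].
  rewrite (eq_bigr (fun=> 1)) => [|x _]; last exact/eqP.
  by rewrite sumr_const natz mulrC.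
rewrite negb_forall => /existsP[w bw].
rewrite (sum_opp_eq0 (h := +%R w)) ?mulr0 //; first exact: addrI.
move=> x; rewrite bD; have /eqP := b2 y w.
by rewrite sqrf_eq1 (negPf bw) /= => /eqP ->; rewrite mulN1r.
Qed.

Lemma even_sqr (S m : int) : S ^+ 2 = 2 * m -> exists s, S = 2 * s.
Proof.
move=> E; exists (S %/ 2)%Z.
have [//|S1] : S = 2 * (S %/ 2)%Z \/ S = 2 * (S %/ 2)%Z + 1 by lia.
by move: (S %/ 2)%Z S1 E => k ->; rewrite expr2; nia.
Qed.

(** Descent: while n is at least 3, S is even and halving it removes a factor 4 from the power of 2.
    At n = 1, evenness of S supplies the extra factor 2. *)
Lemma odd_pow2_dvd_sqr n (S m : int) : odd n -> S ^+ 2 = (2 ^ n)%N%:Z * m ->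
  exists s, S ^+ 2 = 2 * (2 ^ n)%N%:Z * s ^+ 2.
Proof.
move=> on; rewrite -(odd_double_half n) on add1n.
elim: (n./2) S m => [|h IH] S m E.
  have [s ->] := even_sqr E.
  by exists s; rewrite expn1; ring.
have E2 : (2 ^ h.+1.*2.+1)%N%:Z = 4 * (2 ^ h.*2.+1)%N%:Z.
  by rewrite doubleS !expnS; lia.
rewrite E2 in E *; move: (2 ^ _)%N%:Z IH E => Q IH E.
have [S' ES] : exists s, S = 2 * s.
  by apply: (@even_sqr _ (2 * Q * m)); rewrite E; ring.
have [s Es] : exists s, S' ^+ 2 = 2 * Q * s ^+ 2.
  by apply: (IH _ m); move: E; rewrite ES exprMn; lia.
by exists s; rewrite ES exprMn Es; ring.
Qed.

(** * Power moments of the sums attached to the dual code *)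

Definition phase (L : finFieldType) (psi : L -> int) (a b : nat) (u : L * L * L) (x : L) :=
  psi (u.1.1 * x + u.1.2 * x ^+ a + u.2 * x ^+ b).

Definition expsum (L : finFieldType) (psi : L -> int) a b (u : L * L * L) :=
  \sum_x phase psi a b u x.

Section Moments.

Variables (L : finFieldType) (psi : L -> int) (a b : nat).
Hypotheses (a_gt0 : (0 < a)%N) (b_gt0 : (0 < b)%N).
Hypotheses (psiD : forall x y, psi (x + y) = psi x * psi y)
           (psi2 : forall x, psi x ^+ 2 = 1) (psiN : exists v, psi v = -1).

Local Notation q := (#|L|%:Z).
Local Notation Z := (zero_synd L a b).
Local Notation ph := (phase psi a b).
Local Notation S := (expsum psi a b).

Lemma psi0 : psi 0 = 1.
Proof. by rewrite -(psi2 0) expr2 -psiD addr0. Qed.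

Lemma phase0r u : ph u 0 = 1.
Proof. by rewrite /phase !expr0n !gtn_eqF // !mulr0 !addr0 psi0. Qed.

Lemma expsum0 : S 0 = q.
Proof.
rewrite /expsum (eq_bigr (fun=> 1)) ?sumr_const ?natz // => x _.
by rewrite /phase !mul0r !addr0 psi0.
Qed.

Lemma prod_phase u (A : {set L}) : \prod_(x in A) ph u x =
  psi (u.1.1 * (\sum_(x in A) x) + u.1.2 * (\sum_(x in A) x ^+ a)
       + u.2 * (\sum_(x in A) x ^+ b)).
Proof. by rewrite !mulr_sumr -!big_split /= (big_morph psi psiD psi0). Qed.

(** Orthogonality: if one of the three sums is nonzero, translating the matching coordinate of u by
    v divided by that sum changes every sign. *)
Lemma sum_prod_phase (A : {set L}) :
  \sum_u \prod_(x in A) ph u x = q ^+ 3 * (A \in Z)%:Z.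
Proof.
under eq_bigr => u _ do rewrite prod_phase.
rewrite inE; move: (\sum_(x in A) x) (\sum_(x in A) x ^+ a) (\sum_(x in A) x ^+ b) => x y z.
have [v psiv] := psiN.
have [->|x0] /= := eqVneq x 0; last first.
  rewrite mulr0 (sum_opp_eq0 (h := fun u => (u.1.1 + v / x, u.1.2, u.2))) //=.
    by move=> [[? ?] ?] [[? ?] ?] /= [/addIr -> -> ->].
  by move=> u; rewrite -mulN1r -psiv -psiD mulrDl divfK //; congr psi; ring.
have [->|y0] /= := eqVneq y 0; last first.
  rewrite mulr0 (sum_opp_eq0 (h := fun u => (u.1.1, u.1.2 + v / y, u.2))) //=.
    by move=> [[? ?] ?] [[? ?] ?] /= [-> /addIr -> ->].
  move=> u; rewrite -mulN1r -psiv -psiD mulrDl divfK //; congr psi; ring.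
have [->|z0] /= := eqVneq z 0; last first.
  rewrite mulr0 (sum_opp_eq0 (h := fun u => (u.1.1, u.1.2, u.2 + v / z))) //=.
    by move=> [[? ?] ?] [[? ?] ?] /= [-> -> /addIr ->].
  move=> u; rewrite -mulN1r -psiv -psiD mulrDl divfK //; congr psi; ring.
under eq_bigr => u _ do rewrite !mulr0 !addr0 psi0.
by rewrite sumr_const !card_prod natz !PoszM mulr1; ring.
Qed.

Lemma expsum_moment j :
  \sum_u S u ^+ j = q ^+ 3 * \sum_(A in Z) walk_count q j #|A|.
Proof.
under eq_bigr => u _ do rewrite (sum_expn_flip j (fun x => psi2 _)).
rewrite exchange_big /= mulr_sumr [RHS]big_mkcond; apply: eq_bigr => A _.
rewrite -mulr_sumr sum_prod_phase.
by case: ifP; rewrite ?mulr0 // mulr1 mulrC.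
Qed.

Lemma zero_synd0 : set0 \in Z.
Proof. by rewrite inE !big_set0 !eqxx. Qed.

Lemma zero_synd_flip A : A \in Z -> flip 0 A \in Z.
Proof. by rewrite !inE !sum_flip0 // expr0n gtn_eqF. Qed.

(** The empty set and {0} are the only members of size at most d, and j steps cannot reach a set of
    more than j points. *)
Lemma expsum_moment_small d j : (0 < d)%N ->
  (forall A, A \in Z -> (#|A| <= d)%N -> A \subset [set 0]) -> (j <= d)%N ->
  \sum_u S u ^+ j = q ^+ 3 * (walk_count q j 0 + walk_count q j 1).
Proof.
move=> d0 dist jd; rewrite expsum_moment; congr (_ * _).
have Z1 : [set 0] \in Z.
  have <- : flip 0 set0 = [set 0] :> {set L} by rewrite flip_notin ?inE // setU0.
  by rewrite zero_synd_flip ?zero_synd0.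
have ne : [set 0] != set0 :> {set L} by rewrite -cards_eq0 cards1.
rewrite (bigD1 set0) ?zero_synd0 //= cards0 (bigD1 [set 0]) ?Z1 ?ne //= cards1.
rewrite [X in _ + (_ + X)]big1 ?addr0 // => A /andP[/andP[AZ An0] An1].
apply: walk_count_gt; rewrite ltnNge; apply/negP => Aj.
have := dist A AZ (leq_trans Aj jd).
by rewrite subset1 (negPf An0) (negPf An1).
Qed.

End Moments.

(** * Values of the sums, weight 7 and the dimension *)

Section QuadraticCode.

Variables (L : finFieldType) (psi : L -> int) (n k m : nat).
Hypotheses (odd_n : odd n) (n_gt3 : (3 < n)%N) (cardL : #|L| = (2 ^ n)%N).
Hypotheses (psiD : forall x y, psi (x + y) = psi x * psi y)
           (psi2 : forall x, psi x ^+ 2 = 1) (psiN : exists v, psi v = -1).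

Local Notation q := (#|L|%:Z).
Local Notation a := (2 ^ k + 1)%N.
Local Notation b := (2 ^ m + 1)%N.
Local Notation Z := (zero_synd L a b).
Local Notation S := (expsum psi a b).

Hypothesis dist6 : forall A, A \in Z -> (#|A| <= 6)%N -> A \subset [set 0].

Let charL : 2%N \in [pchar L] := card_finPcharP cardL isT.
Let a_gt0 : (0 < a)%N. Proof. by rewrite addn1. Qed.
Let b_gt0 : (0 < b)%N. Proof. by rewrite addn1. Qed.

Lemma card_ge32 : 32 <= q.
Proof.
have n5 : (5 <= n)%N by case: n odd_n n_gt3 => [|[|[|[|[|]]]]].
have : (2 ^ 5 <= 2 ^ n)%N by rewrite leq_pexp2l.
by rewrite cardL; lia.
Qed.

Lemma expsum_sqr u : exists s, S u ^+ 2 = 2 * q * s ^+ 2.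
Proof.
(* The exponents 2^k + 1 and 2^m + 1 make the phase quadratic; B is its polarization. *)
pose B (y x : L) := u.1.2 * (x * y ^+ (2 ^ k) + x ^+ (2 ^ k) * y)
                    + u.2 * (x * y ^+ (2 ^ m) + x ^+ (2 ^ m) * y).
have pD j (x y : L) : (x + y) ^+ (2 ^ j) = x ^+ (2 ^ j) + y ^+ (2 ^ j).
  by rewrite exprDn_pchar // pnatX pnatE // charL.
have [||||M] := @quadratic_sum_sqr L (phase psi a b u) (fun y x => psi (B y x)).
- by move=> x; apply: psi2.
- move=> x y; rewrite /phase /B -!psiD !addn1 !exprS !pD; congr psi; ring.
- by move=> y x x'; rewrite -psiD /B !pD; congr psi; ring.
- by move=> y x; apply: psi2.
by rewrite -/(expsum _ _ _ _) cardL; apply: odd_pow2_dvd_sqr.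
Qed.

(** Writing S^2 = 2 q s^2, the sign is that of s^2 (s^2 - 1) (s^2 - 4), and no integer square lies
    strictly between 1 and 4. *)
Lemma expsum_sextic_ge0 u : 0 <= S u ^+ 2 * (S u ^+ 2 - 2 * q) * (S u ^+ 2 - 8 * q).
Proof.
have [s ->] := expsum_sqr u.
have -> : 2 * q * s ^+ 2 * (2 * q * s ^+ 2 - 2 * q) * (2 * q * s ^+ 2 - 8 * q)
   = 8 * q ^+ 3 * (s ^+ 2 * ((s ^+ 2 - 1) * (s ^+ 2 - 4))) by ring.
apply: mulr_ge0; first by rewrite mulr_ge0 ?exprn_ge0.
have [s1|s2] := leP (`|s|) 1.
  have : s = 0 \/ s = 1 \/ s = -1 by lia.
  by case=> [->|[->|->]].
have s4 : 4 <= s ^+ 2 by rewrite expr2; nia.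
by move: (s ^+ 2) s4 => w w4; rewrite !mulr_ge0 ?subr_ge0 //; lia.
Qed.

Lemma sumS_split (F : int -> int) : \sum_u F (S u) = F q + \sum_(u : L * L * L | u != 0) F (S u).
Proof. by rewrite (bigD1 (0 : L * L * L)) //= expsum0. Qed.

(* The term at u = 0 already accounts for the whole sum of the nonnegative sextic. *)
Lemma expsum_sextic u : u != 0 -> S u ^+ 2 * (S u ^+ 2 - 2 * q) * (S u ^+ 2 - 8 * q) = 0.
Proof.
pose P (x : int) := x ^+ 2 * (x ^+ 2 - 2 * q) * (x ^+ 2 - 8 * q).
have mom := expsum_moment_small a_gt0 b_gt0 psiD psi2 psiN (isT : (0 < 6)%N) dist6.
have : \sum_u P (S u) = P q.
  transitivity (\sum_u S u ^+ 6 - 10 * q * \sum_u S u ^+ 4 + 16 * q ^+ 2 * \sum_u S u ^+ 2).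
    rewrite !mulr_sumr -sumrN -!big_split /=; apply: eq_bigr => v _; rewrite /P; ring.
  by rewrite !mom // /P /=; ring.
rewrite sumS_split => /(canRL (addKr _)); rewrite addNr => P0 u0.
exact: (psumr_eq0P (fun v _ => expsum_sextic_ge0 v) P0).
Qed.

Lemma expsum_rec u j : u != 0 ->
  S u ^+ (j + 5) = 10 * q * S u ^+ (j + 3) - 16 * q ^+ 2 * S u ^+ (j + 1).
Proof.
move=> /expsum_sextic; rewrite !exprD; move: (S u) => x.
have [->|x0 H] := eqVneq x 0; first by move=> _; ring.
apply: (mulIf x0); apply/eqP; rewrite -subr_eq0; apply/eqP.
by rewrite -[RHS](mulr0 (x ^+ j)) -H; ring.
Qed.

(** The last bracket corrects for u = 0, where the sum is q and the recurrence of [expsum_rec]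
    fails. *)
Lemma expsum_moment_rec j : \sum_u S u ^+ (j + 5) =
  10 * q * \sum_u S u ^+ (j + 3) - 16 * q ^+ 2 * \sum_u S u ^+ (j + 1)
  + (q ^+ (j + 5) - 10 * q * q ^+ (j + 3) + 16 * q ^+ 2 * q ^+ (j + 1)).
Proof.
rewrite (sumS_split (fun x => x ^+ (j + 5))) (sumS_split (fun x => x ^+ (j + 3))).
rewrite (sumS_split (fun x => x ^+ (j + 1))).
rewrite (eq_bigr _ (fun u => expsum_rec j (u:=u))) sumrB -!mulr_sumr.
ring.
Qed.

(** Otherwise the explicit moments would be valid up to order 7, and the recurrence linking orders
    7, 5 and 3 would become a polynomial equation in q with no solution for q >= 32. *)
Lemma exists_zero_synd7 : exists2 A, A \in Z & (0 \notin A) && (#|A| == 7%N).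
Proof.
apply/exists_inP; apply: contraT; rewrite negb_exists_in => /forall_inP no7.
have dist7 A : A \in Z -> (#|A| <= 7)%N -> A \subset [set 0].
  move=> AZ; rewrite leq_eqVlt => /orP[A7|]; last exact: dist6.
  have := no7 A AZ; rewrite A7 andbT negbK => A0.
  (* A member of size 7 through 0 would leave one of size 6 when 0 is removed. *)
  have c6 : #|flip 0 A| = 6 by rewrite card_flip A0 (eqP A7).
  have := dist6 (zero_synd_flip a_gt0 b_gt0 AZ); rewrite c6 => /(_ isT) /subset_leq_card.
  by rewrite c6 cards1.
have mom := expsum_moment_small a_gt0 b_gt0 psiD psi2 psiN (isT : (0 < 7)%N) dist7.
have := expsum_moment_rec 2; rewrite !mom // /=.
have := card_ge32; move: q => Q Q32.
move/eqP; rewrite -subr_eq0; set X := _ - _.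
(* The polynomial is grouped so that every summand is visibly nonnegative for Q >= 32, with a
   positive constant term. *)
have -> : X = - (Q ^+ 3 * (Q ^+ 3 * (Q - 13) + Q * (168 * Q - 428) + 272)).
  rewrite /X; ring.
rewrite oppr_eq0 mulf_eq0 expf_eq0 /= => /orP[|] /eqP; first lia.
have h1 : 0 <= Q ^+ 3 * (Q - 13) by rewrite mulr_ge0 ?exprn_ge0 //; lia.
have h2 : 0 <= Q * (168 * Q - 428) by rewrite mulr_ge0 //; lia.
lia.
Qed.

(** Otherwise the sum at u is q, which is not a root of the sextic as q > 8. This is the
    independence of the 3n parity checks. *)
Lemma phaseN1 u : u != 0 -> exists2 x, x != 0 & phase psi a b u x = -1.
Proof.
move=> u0; have [x /andP[x0 /eqP phx]|phN1] :=
  pickP (fun x => (x != 0) && (phase psi a b u x == -1)); first by exists x.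
have Sq : S u = q.
  rewrite /expsum (eq_bigr (fun=> 1)) ?sumr_const ?natz // => x _.
  have [->|x0] := eqVneq x 0; first by rewrite phase0r.
  have := psi2 (u.1.1 * x + u.1.2 * x ^+ a + u.2 * x ^+ b).
  move/eqP; rewrite sqrf_eq1 => /orP[/eqP //|phx].
  by have := phN1 x; rewrite x0 /phase phx.
have := expsum_sextic u0; rewrite Sq; have := card_ge32.
move: q => Q Q32 H; have : 0 < Q ^+ 4 * ((Q - 2) * (Q - 8)).
  by rewrite !mulr_gt0 ?exprn_gt0 ?subr_gt0 //; lia.
by rewrite (_ : _ * _ = 0) ?ltxx // -H; ring.
Qed.

(** Double counting of the products of phases over pairs (A, u) with 0 outside A. Orthogonality
    evaluates the sum over u; the sum over A vanishes for nonzero u, by toggling a point of phase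
    -1. *)
Lemma card_zero_synd_pointed :
  (#|L| ^ 3 * #|[set A : {set L} in Z | 0%R \notin A]| = 2 ^ (#|L| - 1))%N.
Proof.
pose W := [set A : {set L} | 0 \notin A].
have cardW : #|W| = (2 ^ (#|L| - 1))%N.
  have -> : W = powerset [set~ 0].
    by apply/setP=> A; rewrite !inE subsetC sub1set inE.
  by rewrite card_powerset cardsC1 subn1.
have chi u : \sum_(A in W) \prod_(x in A) phase psi a b u x =
    (u == 0)%:R * (2 ^ (#|L| - 1))%N%:Z.
  have [->|u0] := eqVneq u 0.
    rewrite (eq_bigr (fun=> 1)) ?sumr_const ?cardW ?mul1r ?natz // => A _.
    by rewrite prod_phase // !mul0r !addr0 psi0.
  have [w w0 phw] := phaseN1 u0.
  rewrite mul0r big_mkcond /= (sum_opp_eq0 (h := flip w)) //.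
    exact: can_inj (flipK w).
  move=> A; rewrite !inE eq_sym (negPf w0) /=.
  by case: ifP; rewrite ?oppr0 // prod_flip ?phw ?mulN1r.
apply/eqP; rewrite -eqz_nat; apply/eqP.
transitivity (\sum_(A in W) \sum_u \prod_(x in A) phase psi a b u x).
  under eq_bigr => A _ do rewrite sum_prod_phase //.
  rewrite -mulr_sumr PoszM; congr (_ * _).
  rewrite (eq_bigr (fun A => if A \in Z then 1 else 0)) => [|A _]; last by case: ifP.
  rewrite -big_mkcondr sumr_const natz; congr Posz; apply: eq_card => A.
  rewrite inE -[RHS]topredE /= [in RHS]inE. exact: andbC.
rewrite exchange_big /=; under eq_bigr => u _ do rewrite chi.
by rewrite -mulr_suml (bigD1 (0 : L * L * L)) //= eqxx big1 ?addr0 ?mul1r // => u /negPf ->.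
Qed.

End QuadraticCode.

(** * Comparison of weight distributions *)

(** Toggling 0 in a member of odd size at most 5 gives one of even size at most 6, which must be
    empty. *)
Lemma zero_synd_small (L : finFieldType) (n k t : nat) (A : {set L}) :
  odd n -> (0 < k)%N -> coprime k n -> (t == 2%N) || (t == 3%N) ->
  #|L| = (2 ^ n)%N ->
  A \in zero_synd L (2 ^ k + 1) (2 ^ (t * k) + 1) -> (#|A| <= 6)%N ->
  A \subset [set 0].
Proof.
move=> on k0 cop ht cardL AZ A6.
have even0 := zero_synd_even on k0 cop ht cardL.
have [oA|eA] := boolP (odd #|A|); last by rewrite (even0 A) ?sub0set.
have fA0 : flip 0 A = set0.
  apply: even0; first by apply: zero_synd_flip AZ; rewrite addn1.
  - by rewrite card_flip; case: ifP => _; case: #|A| oA => //= c; rewrite ?negbK.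
  - by rewrite card_flip; case: ifP => _; lia.
by rewrite -[A](flipK 0) fA0 flip_notin ?inE // setU0.
Qed.

(** * Weight counts with and without the point 0 *)

Section WeightEnumerator.

Variable L : finFieldType.
Implicit Types Z : {set {set L}}.

Definition card_at Z s := #|[set A : {set L} in Z | #|A| == s]|.

Lemma sum_card_at Z (g : nat -> int) :
  \sum_(A in Z) g #|A| = \sum_(s < #|L|.+1) (card_at Z s)%:Z * g s.
Proof.
have cardlt (A : {set L}) : (#|A| < #|L|.+1)%N by rewrite ltnS max_card.
rewrite (partition_big (fun A : {set L} => Ordinal (cardlt A)) xpredT) //=.
apply: eq_bigr => s _.
rewrite (eq_bigr (fun=> g s)) => [|A /andP[_ /eqP <-]] //.
rewrite sumr_const -mulr_natl natz; congr (Posz _ * _).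
by apply: eq_card => A; rewrite [RHS]inE -[LHS]topredE.
Qed.

(** Strong induction on the size j: the moment of order j involves only sizes up to j, and size j
    enters with coefficient j!. *)
Lemma card_at_eq Z Z' :
  (forall j, \sum_(A in Z) walk_count #|L| j #|A| =
             \sum_(A in Z') walk_count #|L| j #|A|) ->
  card_at Z =1 card_at Z'.
Proof.
move=> mom; elim/ltn_ind => j IH.
have [jq|qj] := leqP j #|L|; last first.
  have big0 Y : card_at Y j = 0%N.
    apply: eq_card0 => A; rewrite !inE; apply/negbTE; rewrite negb_and ltn_eqF ?orbT //.
    exact: leq_ltn_trans (max_card _) qj.
  by rewrite !big0.
have := mom j; rewrite !sum_card_at => /eqP; rewrite -subr_eq0 -sumrB.
rewrite (bigD1 (Ordinal (jq : (j < #|L|.+1)%N))) //= big1 => [|s sj].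
  rewrite addr0 walk_count_diag -mulrBl mulf_eq0 subr_eq0.
  by case/orP=> [/eqP[]|] //; rewrite eqz_nat gtn_eqF ?fact_gt0.
have [js|js|ejs] := ltngtP j s.
- by rewrite walk_count_gt // !mulr0 subrr.
- by rewrite IH // subrr.
- by case/eqP: sj; apply: val_inj.
Qed.

(** These sets are exactly the supports of codewords, which live on nonzero points. *)
Definition pointed_at Z s := #|[set A : {set L} in Z | (0 \notin A) && (#|A| == s)]|.

(** Removing 0 matches the members of size s + 1 through 0 with the members of size s that avoid
    it. *)
Lemma card_atS Z s : (forall A, A \in Z -> flip 0 A \in Z) ->
  card_at Z s.+1 = (pointed_at Z s.+1 + pointed_at Z s)%N.
Proof.
move=> Zflip; have ZflipE A : (flip 0 A \in Z) = (A \in Z).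
  by apply/idP/idP => /Zflip //; rewrite flipK.
rewrite /card_at -(cardsID [set A : {set L} | 0 \in A]) addnC; congr (_ + _)%N.
  by apply: eq_card => A; rewrite !inE; case: (0 \in A); rewrite ?andbF ?andbT.
rewrite -[RHS](card_imset _ (can_inj (flipK 0))); apply: eq_card => A.
rewrite -[in RHS](flipK 0 A) mem_imset; last exact: can_inj (flipK 0).
rewrite !inE ZflipE card_flip eqxx /=.
by case: (A \in Z) => //=; case: ifP; rewrite ?andbF ?andbT //= => A0;
  rewrite (cardsD1 0 A) A0.
Qed.

Lemma card_at0 Z : card_at Z 0 = pointed_at Z 0.
Proof.
apply: eq_card => A; rewrite !inE; case: (A \in Z) => //=.
by rewrite cards_eq0; case: eqVneq => [->|]; rewrite ?inE ?andbF.
Qed.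

Lemma pointed_at_eq Z Z' :
  (forall A, A \in Z -> flip 0 A \in Z) ->
  (forall A, A \in Z' -> flip 0 A \in Z') ->
  card_at Z =1 card_at Z' -> pointed_at Z =1 pointed_at Z'.
Proof.
move=> fZ fZ' E; elim=> [|s IH]; first by rewrite -!card_at0.
by have := E s.+1; rewrite !card_atS // IH => /addIn.
Qed.

Definition supp (c : word L) : {set L} := [set val x | x in [set x | c x != 0]].

Lemma mem_supp c (x : Lstar L) : (val x \in supp c) = (c x != 0).
Proof. by rewrite mem_imset ?inE //; exact: val_inj. Qed.

Lemma supp_notin0 c : 0 \notin supp c.
Proof. by apply/imsetP => -[x _ x0]; have := valP x; rewrite -x0 eqxx. Qed.

Lemma supp_inj : injective supp.
Proof.
move=> c d E; apply/ffunP => x; have := mem_supp c x; rewrite E mem_supp.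
by case: (F2_cases (c x)) => ->; case: (F2_cases (d x)) => ->.
Qed.

Lemma card_supp c : #|supp c| = wt c.
Proof. by rewrite card_imset //; exact: val_inj. Qed.

Lemma supp_code a b c : (supp c \in zero_synd L a b) = (c \in code L a b).
Proof.
have sumE (f : L -> L) : \sum_(x in supp c) f x =
    \sum_(x : Lstar L) (c x : nat)%:R * f (val x).
  rewrite big_imset /= => [|x y _ _]; last exact: val_inj.
  rewrite big_mkcond /=; apply: eq_bigr => x _; rewrite inE.
  by case: (F2_cases (c x)) => ->; rewrite ?mul0r ?mul1r.
by rewrite !inE !sumE.
Qed.

Lemma supp_surj (A : {set L}) : 0 \notin A -> exists c, supp c = A.
Proof.
move=> A0; exists [ffun x : Lstar L => (val x \in A)%:R : 'F_2].
apply/setP=> x; have [->|x0] := eqVneq x 0.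
  by rewrite (negPf A0); apply/negbTE/supp_notin0.
have -> : x = val (Sub x x0 : Lstar L) by rewrite SubK.
by rewrite mem_supp ffunE; case: (_ \in A).
Qed.

Lemma card_code (P : pred nat) a b :
  #|[set c in code L a b | P (wt c)]| =
  #|[set A : {set L} in zero_synd L a b | (0 \notin A) && P #|A|]|.
Proof.
rewrite -(card_imset _ supp_inj); apply: eq_card => A; rewrite [RHS]inE.
have [A0|A0] := boolP (0 \in A).
  rewrite andbF; apply/negbTE/imsetP => -[c _ Ac].
  by move: A0; rewrite Ac (negPf (supp_notin0 c)).
have [c <-] := supp_surj A0.
rewrite mem_imset; last exact: supp_inj.
by rewrite inE -supp_code card_supp.
Qed.

End WeightEnumerator.

(** Up to order 6 the moments are explicit in q; beyond that both families obey the same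
    recurrence. *)
Lemma zero_synd_moment_eq (L : finFieldType) (n k m k' m' : nat) :
  odd n -> (3 < n)%N -> #|L| = (2 ^ n)%N ->
  (forall A, A \in zero_synd L (2 ^ k + 1) (2 ^ m + 1) -> (#|A| <= 6)%N ->
     A \subset [set 0]) ->
  (forall A, A \in zero_synd L (2 ^ k' + 1) (2 ^ m' + 1) -> (#|A| <= 6)%N ->
     A \subset [set 0]) ->
  forall j, \sum_(A in zero_synd L (2 ^ k + 1) (2 ^ m + 1)) walk_count #|L| j #|A| =
    \sum_(A in zero_synd L (2 ^ k' + 1) (2 ^ m' + 1)) walk_count #|L| j #|A|.
Proof.
move=> on n3 cardL d d' j.
have charL := card_finPcharP cardL isT.
have [psi [psiD psi2] psiN] := exists_character charL.
have q0 : #|L|%:Z ^+ 3 != 0 by rewrite expf_neq0 // cardL eqz_nat -lt0n expn_gt0.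
have pos i : (0 < 2 ^ i + 1)%N by rewrite addn1.
apply: (mulfI q0); rewrite -!(expsum_moment (psi := psi)) //.
elim/ltn_ind: j => j IH.
have [j6|j6] := leqP j 6.
  have mom := expsum_moment_small (pos _) (pos _) psiD psi2 psiN (isT : (0 < 6)%N).
  by rewrite (mom _ _ _ d j6) (mom _ _ _ d' j6).
have -> : j = (j - 5 + 5)%N by lia.
rewrite !(expsum_moment_rec on n3 cardL psiD psi2 psiN) //.
by rewrite !IH //; lia.
Qed.

Theorem theorem1 (L : finFieldType) (n k t : nat) :
  odd n -> (3 < n)%N -> (0 < k)%N -> coprime k n -> (t == 2%N) || (t == 3%N) ->
  #|L| = (2 ^ n)%N ->
  let C := code L (2 ^ k + 1) (2 ^ (t * k) + 1) in
  [/\ #|{: Lstar L}| = (2 ^ n - 1)%N,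
      #|C| = (2 ^ (2 ^ n - 3 * n - 1))%N,
      (exists2 c, c \in C & (c != 0%R) && (wt c == 7%N)),
      (forall c, c \in C -> c != 0%R -> (7 <= wt c)%N)
    & forall w : nat,
        #|[set c in C | wt c == w]| = #|[set c in bch3 L | wt c == w]| ].
Proof.
move=> on n3 k0 cop ht cardL C.
have charL := card_finPcharP cardL isT.
have [psi [psiD psi2] psiN] := exists_character charL.
have dist A := @zero_synd_small L n k t A on k0 cop ht cardL.
(* The BCH exponents 3 and 5 are the case k = 1, t = 2. *)
have dist' A := @zero_synd_small L n 1 2 A on isT (coprime1n n) isT cardL.
have flipZ i j A := @zero_synd_flip L (2 ^ i + 1) (2 ^ j + 1) A.
split.
- by rewrite card_sig -cardL subn1 -(cardC1 (0 : L)); apply: eq_card.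
- have := card_zero_synd_pointed on n3 cardL psiD psi2 psiN dist.
  have <- : #|C| = #|[set A : {set L} in zero_synd L (2 ^ k + 1) (2 ^ (t * k) + 1) | 0 \notin A]|.
    rewrite (_ : C = [set c in C | xpredT (wt c)]); last by apply/setP=> c; rewrite inE andbT.
    by rewrite (card_code _ xpredT); apply: eq_card => A; rewrite !inE andbT.
  (* This makes the truncated subtraction in the exponent of the dimension an honest one. *)
  have n3q : (3 * n + 1 <= 2 ^ n)%N.
    by rewrite -(subnK n3); elim: (n - 4)%N => // i IH; rewrite addSn expnS; lia.
  rewrite cardL -expnM => E; apply/eqP.
  rewrite -(eqn_pmul2l (m := 2 ^ (n * 3))) ?expn_gt0 // E -expnD; apply/eqP.
  congr (_ ^ _)%N; lia.
- have [A AZ /andP[A0 /eqP A7]] := exists_zero_synd7 on n3 cardL psiD psi2 psiN dist.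
  have [c cA] := supp_surj A0; exists c; first by rewrite -supp_code cA.
  rewrite -card_supp cA A7 andbT; apply: contra_eq_neq A7 => c0.
  by rewrite -cA c0 card_supp /wt eq_card0 // => x; rewrite !inE ffunE.
- move=> c cC; apply: contraNT; rewrite -ltnNge ltnS => c6.
  rewrite -supp_code in cC; have := dist _ cC; rewrite card_supp => /(_ c6) /subsetP s0.
  apply/eqP/ffunP => x; rewrite ffunE; apply/eqP; apply: contraT.
  by rewrite -mem_supp => /s0; rewrite inE (negPf (valP x)).
- move=> w; rewrite !(card_code _ (pred1 w)).
  apply: (@pointed_at_eq L (zero_synd L (2 ^ k + 1) (2 ^ (t * k) + 1))
    (zero_synd L (2 ^ 1 + 1) (2 ^ (2 * 1) + 1))).
  + by move=> A; apply: flipZ; rewrite addn1.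
  + by move=> A; apply: flipZ; rewrite addn1.
  + exact: card_at_eq (zero_synd_moment_eq on n3 cardL dist dist').
Qed.
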